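(* Let $k=k(n)$ and $m=m(n)$ be functions of $n$ such that $m\geq n$. (i) If $\liminf_{n\rightarrow\infty} \frac{k^2n}{m\log n}>1$, then asymptotically almost surely $G(n,m,k)$ is connected. (ii) If $\limsup_{n\rightarrow\infty} \frac{k^2n}{m\log n}<1$, then asymptotically almost surely $G(n,m,k)$ is not connected.
   Context: The uniform random intersection graph $G(n,m,k)$ (for positive integers $k\le m$) is the random graph on a set $V$ of $n$ nodes defined as follows: fix a set $M$ of $m$ colours; to each node $v\in V$ assign a subset $F_v\subseteq M$ of exactly $k$ distinct colours, chosen uniformly at random among all $k$-subsets of $M$, independently for different nodes; distinct nodes $u,v$ are joined by an edge if and only if $F_u\cap F_v\neq\emptyset$. An event holds asymptotically almost surely if its probability tends to $1$ as $n\rightarrow\infty$. Here $\log$ denotes the natural logarithm. *)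

(* Defs.v *)
From HB Require Import structures.
From mathcomp Require Import all_boot all_order all_algebra.
From mathcomp Require Import all_classical all_reals all_analysis.
Set Implicit Arguments. Unset Strict Implicit. Unset Printing Implicit Defensive.
Import Order.TTheory GRing.Theory Num.Theory.
Local Open Scope ring_scope.

Definition colouring (n m : nat) := {ffun 'I_n -> {set 'I_m}}.

Definition admissible (n m k : nat) (F : colouring n m) : bool :=
  [forall v, #|F v| == k].

Definition ig_edge (n m : nat) (F : colouring n m) : rel 'I_n :=
  fun u v => (u != v) && (F u :&: F v != finset.set0).

Definition ig_connected (n m : nat) (F : colouring n m) : bool :=
  [forall u, forall v, connect (ig_edge F) u v].

(* Probability under G(n,m,k): the k-subsets are chosen uniformly and
   independently, i.e. the uniform distribution on admissible colourings. *)
Definition Prob_G (R : realType) (n m k : nat) (E : colouring n m -> bool) : R :=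
  (#|[pred F : colouring n m | admissible k F && E F]|%:R)
  / (#|[pred F : colouring n m | admissible k F]|%:R).

Definition kkn_ratio (R : realType) (k m : nat -> nat) (n : nat) : R :=
  ((k n)%:R ^+ 2 * n%:R) / ((m n)%:R * ln (n%:R : R)).
Arguments Prob_G R n m k E : clear implicits.

(* Main.v *)
(* Write P for the probability in G(n,m,k).

   (i) If the graph is disconnected, some set S of s <= n/2 nodes is not joined
   to the other nodes.  Let U be the set of colours used by S.  For any u < m,
   either |U| <= u, which by a union bound over the possible supersets of U of
   size u has probability at most C(m,u) (u/m)^(ks), or |U| > u, and then the
   other nodes avoid U with probability at most exp(-(u+1)k(n-s)/m).  When ks is
   small compared with m one takes u = (1-eps)ks, otherwise u is a small multiple
   of m; since m >= n forces k -> oo, both terms multiplied by C(n,s) are at most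
   exp(-Ks) for any fixed K and large n, and summing over s gives
   P(disconnected) <= 4 exp(-K).

   (ii) Second moment method for the number of isolated nodes.  With
   a = C(m-k,k)/C(m,k), a node is isolated with probability a^(n-1), and by
   log-concavity of binomials two nodes are both isolated with probability at most
   a^(2n-3), so P(no isolated node) <= 1/(n a^(n-1)) + 1/a - 1.  The bound
   a >= 1 - k^2/m makes the right-hand side tend to 0. *)
Require Import Defs.
From HB Require Import structures.
From mathcomp Require Import all_boot all_order all_algebra.
From mathcomp Require Import all_classical all_reals all_analysis.
From mathcomp Require Import zify ring lra.
Import Order.TTheory GRing.Theory Num.Theory.
Import numFieldNormedType.Exports.
Set Implicit Arguments. Unset Strict Implicit. Unset Printing Implicit Defensive.

(** * Binomial coefficients and finite counting *)

(** Division-free form of C(u,k)/C(m,k) <= (u/m)^k: each factor (u-i)/(m-i) is at most u/m. *)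
Lemma bin_mul_expn_le u m k : u <= m -> 'C(u, k) * m ^ k <= 'C(m, k) * u ^ k.
Proof.
move=> le_um; elim: k => [|k IHk]; first by rewrite !bin0.
rewrite -(leq_pmul2l (ltn0Sn k)) !mulnA !mul_bin_left !expnS.
have le_k : (u - k) * m <= (m - k) * u by nia.
by have := leq_mul le_k IHk; congr (_ <= _); nia.
Qed.

(** Passing from [j] to [j.+1] multiplies the two sides by (a-j)(a+2d-j) and (a+d-j)^2, which AM-GM
    compares; when [a <= j] the truncated difference makes the left factor zero. *)
Lemma bin_log_concave a d j : 'C(a, j) * 'C(a + 2 * d, j) <= 'C(a + d, j) ^ 2.
Proof.
elim: j => [|j IHj]; first by rewrite !bin0.
rewrite -(leq_pmul2l (ltn0Sn j)) -(leq_pmul2l (ltn0Sn j)).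
have -> : j.+1 * (j.+1 * ('C(a, j.+1) * 'C(a + 2 * d, j.+1))) =
  (a - j) * (a + 2 * d - j) * ('C(a, j) * 'C(a + 2 * d, j)).
  transitivity ((j.+1 * 'C(a, j.+1)) * (j.+1 * 'C(a + 2 * d, j.+1))); first by lia.
  by rewrite !mul_bin_left; lia.
have -> : j.+1 * (j.+1 * 'C(a + d, j.+1) ^ 2) =
  (a + d - j) ^ 2 * 'C(a + d, j) ^ 2.
  by rewrite -expnMn -mul_bin_left expnMn; lia.
by apply: leq_mul IHj; have [?|?] := leqP a j; nia.
Qed.

(** Pascal's rule [j] times: deleting one element destroys at most C(m-1,k) of the (k+1)-subsets. *)
Lemma bin_sub_ge m k j : j <= m -> 'C(m, k.+1) <= 'C(m - j, k.+1) + j * 'C(m.-1, k).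
Proof.
elim: j => [|j IHj] le_jm; first by rewrite subn0 addn0.
apply: leq_trans (IHj (ltnW le_jm)) _.
have -> : m - j = (m - j.+1).+1 by lia.
rewrite binS mulSn -addnA leq_add2l leq_add2r leq_bin2l //; lia.
Qed.

(** Division-free form of C(m-k,k)/C(m,k) >= 1 - k^2/m, obtained by deleting [k] elements and using
    m C(m-1,k-1) = k C(m,k). *)
Lemma bin_disjoint_ge m k : 0 < k -> k <= m ->
  m * 'C(m, k) <= m * 'C(m - k, k) + k * k * 'C(m, k).
Proof.
case: k => // k _ le_km; have := bin_sub_ge k le_km; rewrite -[k.+1 * _ * _]mulnA.
have <- : m * 'C(m.-1, k) = k.+1 * 'C(m, k.+1).
  by case: m le_km => // m _; rewrite -mul_bin_diag.
nia.
Qed.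

Lemma card_union_bound (T I : finType) (P : pred T) (Q : pred I) (E : I -> pred T) :
  (forall x, P x -> exists2 i, Q i & E i x) -> #|P| <= \sum_(i | Q i) #|E i|.
Proof.
move=> PE; rewrite -sum1_card.
under [X in _ <= X]eq_bigr do rewrite -sum1_card big_mkcond.
rewrite exchange_big /= big_mkcond; apply: leq_sum => x _.
case: ifP => // /PE[i Qi Eix]; rewrite (bigD1 i) //=.
by have -> : x \in E i by [].
Qed.

(** The hypothesis packs two facts: [f] maps [P] into [Q], and its fibre over each [i] in [Q] is
    exactly [E i]. *)
Lemma card_fiber (T I : finType) (f : T -> I) (P : pred T) (Q : pred I) (E : I -> pred T) :
  (forall x i, P x && (f x == i) = Q i && E i x) -> #|P| = \sum_(i | Q i) #|E i|.
Proof.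
move=> PE; rewrite -sum1_card (partition_big f Q) => [|x Px].
  apply: eq_bigr => i Qi; rewrite -sum1_card; apply: eq_bigl => x.
  by have -> : (x \in P) = P x by []; rewrite PE Qi.
have {}Px : P x by [].
by have := PE x (f x); rewrite Px eqxx => /esym/andP[].
Qed.

(** Padding to size exactly [u] lets a later union bound run over only C(m,u) colour sets. *)
Lemma superset_card (T : finType) (A : {set T}) u : #|A| <= u -> u <= #|T| ->
  exists2 W : {set T}, A \subset W & #|W| = u.
Proof.
move=> leAu leuT.
have /card_geqP[s [us ss sA]] : u - #|A| <= #|~: A| by have := cardsC A; lia.
exists (A :|: [set x in s]%SET); first exact: finset.subsetUl.
have -> : #|A :|: [set x in s]%SET| = #|A| + #|[set x in s]%SET|.
  apply/eqP; rewrite (leq_card_setU _ _).2; apply/pred0P => x /=; rewrite inE.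
  by apply/negbTE/negP => /andP[xA /sA]; rewrite inE xA.
have -> : #|[set x in s]%SET| = size s by rewrite cardsE; apply/card_uniqP.
by rewrite ss subnKC.
Qed.

Lemma card_family_split (I T : finType) (S : {set I}) (P : I -> pred T) a b :
  (forall v, v \in S -> #|P v| = a) -> (forall v, v \notin S -> #|P v| = b) ->
  #|(family P : pred {ffun I -> T})| = a ^ #|S| * b ^ (#|I| - #|S|).
Proof.
move=> Pa Pb; rewrite card_family foldrE big_map big_enum /= (bigID (mem S)) /=.
rewrite (eq_bigr (fun=> a)) => [|v /Pa //]; rewrite prod_nat_const; congr (_ * _).
rewrite (eq_bigr (fun=> b)) => [|v /Pb //]; rewrite prod_nat_const; congr (_ ^ _).
by rewrite -(cardC (mem S)) addKn; apply: eq_card.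
Qed.

(** * Counting colourings with a cut-off set or isolated nodes *)

Section Counting.
Variables n m k : nat.
Implicit Types (F : colouring n m) (S : {set 'I_n}) (A B U W : {set 'I_m}).

Definition ksub W : pred {set 'I_m} := [pred A : {set 'I_m} | (A \subset W) && (#|A| == k)].

Lemma card_ksub W : #|ksub W| = 'C(#|W|, k).
Proof. by rewrite -cards_draws cardsE; apply: eq_card => A; rewrite !inE. Qed.

Lemma card_ksubT : #|ksub [set: 'I_m]| = 'C(m, k).
Proof. by rewrite card_ksub cardsT card_ord. Qed.

Lemma card_ksubC W : #|ksub (~: W)| = 'C(m - #|W|, k).
Proof. by rewrite card_ksub [#|~: W|]cardsCs finset.setCK card_ord. Qed.

Lemma admissibleP F : reflect (forall v, #|F v| = k) (admissible k F).
Proof. exact: 'forall_eqP. Qed.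

Lemma card_admissible : #|[pred F : colouring n m | admissible k F]| = 'C(m, k) ^ n.
Proof.
rewrite -card_ksubT -[in RHS](card_ord n) -card_ffun_on.
apply: eq_card => F; rewrite !inE; apply/forallP/ffun_onP => h v;
  by have := h v; rewrite !inE finset.subsetT.
Qed.

Definition colours F S : {set 'I_m} := \bigcup_(v in S) F v.

(** No edge leaves [S]. Phrased through the union of the colours of [S], the condition splits into
    independent ones on the outer nodes once the colours inside [S] are fixed. *)
Definition cut_off S F : bool := [forall v, (v \notin S) ==> (F v \subset ~: colours F S)].

Lemma cut_offP S F :
  reflect (forall v, v \notin S -> F v \subset ~: colours F S) (cut_off S F).
Proof. by apply: (iffP forallP) => h v; apply/implyP/h. Qed.

(** Take a connected component or its complement, whichever has at most n/2 nodes; having no common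
    colour across the cut is symmetric in the two sides. *)
Lemma ig_disconnected_cut F : ~~ ig_connected F ->
  exists S, [/\ 0 < #|S|, 2 * #|S| <= n & cut_off S F].
Proof.
rewrite negb_forall => /existsP[u]; rewrite negb_forall => /existsP[v nuv].
pose T := [set w | connect (ig_edge F) u w]%SET.
have sep a b : a \in T -> b \notin T -> F b :&: F a = finset.set0.
  move=> aT bT; apply/eqP; apply: contraR bT => nd; move: aT; rewrite !inE => ua.
  have [<- //|ab] := eqVneq a b; apply: connect_trans ua (connect1 _).
  by rewrite /ig_edge ab finset.setIC.
have cut S : (forall a b, a \in S -> b \notin S -> F b :&: F a = finset.set0) -> cut_off S F.
  move=> sepS; apply/cut_offP => b bS; rewrite -finset.disjoints_subset.
  by apply/bigcup_disjointP => a aS; rewrite -setI_eq0 sepS.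
have cT : #|T| + #|~: T| = n by rewrite cardsC card_ord.
have T0 : 0 < #|T| by apply/card_gt0P; exists u; rewrite inE.
have CT0 : 0 < #|~: T| by apply/card_gt0P; exists v; rewrite !inE.
have [le|gt] := leqP (2 * #|T|) n; first by exists T; split=> //; apply: cut.
exists (~: T); split=> //.
  rewrite -(leq_add2l (2 * #|T|)) -mulnDr cT; lia.
apply: cut => a b; rewrite !inE negbK => aT bT.
by rewrite finset.setIC sep // !inE.
Qed.

(** Union bound over the sets [W] of size [u] containing all colours of [S]: nodes of [S] draw from
    [W], the others freely. *)
Lemma card_small_colours S u : u <= m ->
  #|[pred F : colouring n m | admissible k F && (#|colours F S| <= u)]|
    <= 'C(m, u) * ('C(u, k) ^ #|S| * 'C(m, k) ^ (n - #|S|)).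
Proof.
move=> le_um.
pose fam W := fun v : 'I_n => if v \in S then ksub W else ksub [set: 'I_m].
have := @card_union_bound _ _
  [pred F : colouring n m | admissible k F && (#|colours F S| <= u)]
  (fun W : {set 'I_m} => #|W| == u) (fun W => [pred F : colouring n m | F \in family (fam W)]).
move=> /(_ _)/leq_trans; apply=> [F /andP[/admissibleP kF small]|].
  have [|W sub cW] := superset_card small; first by rewrite card_ord.
  exists W; first exact/eqP.
  apply/familyP => v; rewrite /fam; case: ifP => vS; rewrite inE kF eqxx andbT ?finset.subsetT //.
  by apply: fintype.subset_trans sub; apply: (finset.bigcup_sup v).
rewrite (eq_bigr (fun=> 'C(u, k) ^ #|S| * 'C(m, k) ^ (n - #|S|))) => [|W /eqP cW].
  rewrite sum_nat_const leq_mul2r; apply/orP; right.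
  by rewrite -[X in 'C(X, _)]card_ord -card_draws cardsE.
rewrite (@card_family_split _ _ S (fam W) 'C(u, k) 'C(m, k)).
- by rewrite card_ord.
- by move=> v vS; rewrite /fam vS card_ksub cW.
- by move=> v /negbTE vS; rewrite /fam vS card_ksubT.
Qed.

(** Sum over the restrictions of [F] to [S]: each leaves the outer nodes at most m-(u+1) colours. *)
Lemma card_cut_off S u :
  #|[pred F : colouring n m | [&& admissible k F, u < #|colours F S| & cut_off S F]]|
    <= 'C(m, k) ^ #|S| * 'C(m - u.+1, k) ^ (n - #|S|).
Proof.
pose base := fun v : 'I_n => if v \in S then ksub [set: 'I_m] else pred1 finset.set0.
pose fam (G : colouring n m) := fun v : 'I_n =>
  if v \in S then (pred1 (G v) : pred {set 'I_m}) else ksub (~: colours G S).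
pose Q := [pred G : colouring n m | (G \in family base) && (u < #|colours G S|)].
have := @card_union_bound _ _
  [pred F : colouring n m | [&& admissible k F, u < #|colours F S| & cut_off S F]]
  Q (fun G => [pred F : colouring n m | F \in family (fam G)]).
move=> /(_ _)/leq_trans; apply=> [F /and3P[/admissibleP kF large /cut_offP cF]|].
  (* A restriction to [S] is encoded as a full colouring with the empty set as default outside
     [S]. *)
  pose G : colouring n m := [ffun v => if v \in S then F v else finset.set0].
  have GF : colours G S = colours F S.
    by apply: eq_bigr => v vS; rewrite ffunE vS.
  exists G.
    rewrite inE GF large andbT; apply/familyP => v; rewrite /base ffunE.
    by case: ifP; rewrite !inE ?finset.subsetT ?kF eqxx.
  apply/familyP => v; rewrite /fam GF; case: ifP => [vS|/negbT vS].
    by rewrite inE ffunE vS.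
  by rewrite !inE cF // kF eqxx.
apply: (@leq_trans (\sum_(G | Q G) 'C(m - u.+1, k) ^ (n - #|S|))).
  apply: leq_sum => G /andP[_ large].
  rewrite (@card_family_split _ _ S (fam G) 1 'C(m - #|colours G S|, k)).
  - by rewrite exp1n mul1n card_ord; case: (n - #|S|) => // e; rewrite leq_exp2r // leq_bin2l // leq_sub2l.
  - by move=> v vS; rewrite /fam vS card1.
  - by move=> v /negbTE vS; rewrite /fam vS card_ksubC.
rewrite sum_nat_const leq_mul2r; apply/orP; right.
have <- : #|(family base : pred (colouring n m))| = 'C(m, k) ^ #|S|.
  rewrite (@card_family_split _ _ S base 'C(m, k) 1) ?exp1n ?muln1 //.
  - by move=> v vS; rewrite /base vS card_ksubT.
  - by move=> v /negbTE vS; rewrite /base vS card1.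
by apply/subset_leq_card/fintype.subsetP => G /andP[].
Qed.

Lemma colours1 F v : colours F [set v]%SET = F v.
Proof. by rewrite /colours finset.big_set1. Qed.

(** Classify by the colour set of [v]. The count is exact because the second moment method needs the
    first moment from below as well. *)
Lemma card_isolated v :
  #|[pred F : colouring n m | admissible k F && cut_off [set v]%SET F]|
    = 'C(m, k) * 'C(m - k, k) ^ n.-1.
Proof.
pose fam A := fun w : 'I_n => if w \in [set v]%SET then (pred1 A : pred {set 'I_m}) else ksub (~: A).
rewrite (@card_fiber _ _ (fun F : colouring n m => F v) _ (ksub [set: 'I_m])
  (fun A => [pred F : colouring n m | F \in family (fam A)])) => [|F A /=].
  rewrite (eq_bigr (fun=> 'C(m - k, k) ^ n.-1)) => [|A /andP[_ /eqP cA]].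
    by rewrite sum_nat_const card_ksubT.
  rewrite (@card_family_split _ _ [set v]%SET (fam A) 1 'C(m - k, k)).
  - by rewrite exp1n mul1n card_ord cards1 subn1.
  - by move=> w ws; rewrite /fam ws card1.
  - by move=> w /negbTE ws; rewrite /fam ws card_ksubC cA.
have -> : ksub [set: 'I_m] A = (#|A| == k) by rewrite /ksub /= finset.subsetT.
apply/idP/idP.
  move=> /andP[/andP[/admissibleP kF /cut_offP cF] /eqP <-].
  rewrite kF eqxx; apply/familyP => w; rewrite /fam; case: ifP => [/set1P->|/negbT ws].
    by rewrite inE.
  by rewrite !inE -(colours1 F v) cF // kF eqxx.
move=> /andP[/eqP kA /familyP famF].
have Fv : F v = A by apply/eqP; have := famF v; rewrite /fam set11.
rewrite Fv eqxx andbT; apply/andP; split.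
  apply/admissibleP => w; have := famF w; rewrite /fam; case: ifP => _; rewrite !inE.
    by move=> /eqP->.
  by move=> /andP[_ /eqP].
apply/cut_offP => w /negbTE ws; rewrite colours1 Fv.
by have := famF w; rewrite /fam ws => /andP[].
Qed.

(** The colour sets of [u] and [v] are disjoint, so the remaining n-2 nodes avoid exactly 2k
    colours. *)
Lemma card_isolated_pair u v : u != v ->
  #|[pred F : colouring n m |
     [&& admissible k F, cut_off [set u]%SET F & cut_off [set v]%SET F]]|
    <= 'C(m, k) * 'C(m - k, k) * 'C(m - 2 * k, k) ^ (n - 2).
Proof.
move=> uv.
pose fam (AB : {set 'I_m} * {set 'I_m}) := fun w : 'I_n =>
  if w \in [set u; v]%SET then (pred1 (if w == u then AB.1 else AB.2) : pred {set 'I_m})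
  else ksub (~: (AB.1 :|: AB.2)).
pose Q := [pred AB : {set 'I_m} * {set 'I_m} |
  ksub [set: 'I_m] AB.1 && ksub (~: AB.1) AB.2].
have := @card_union_bound _ _ [pred F : colouring n m |
     [&& admissible k F, cut_off [set u]%SET F & cut_off [set v]%SET F]] Q
  (fun AB => [pred F : colouring n m | F \in family (fam AB)]).
move=> /(_ _)/leq_trans; apply=> [F /and3P[/admissibleP kF /cut_offP cu /cut_offP cv]|].
  exists (F u, F v).
    by rewrite /Q /ksub /= finset.subsetT !kF eqxx andbT -(colours1 F u) cu // inE eq_sym.
  apply/familyP => w; rewrite /fam; case: ifP => [|/negbT].
    by move=> /set2P[]->; rewrite inE ?eqxx // [v == u]eq_sym (negbTE uv).
  rewrite !inE negb_or => /andP[wu wv]; rewrite kF eqxx andbT finset.setCU finset.subsetI.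
  by rewrite -(colours1 F u) -(colours1 F v) cu ?cv // inE.
rewrite (eq_bigr (fun=> 'C(m - 2 * k, k) ^ (n - 2))) => [|[A B] /= /andP[/andP[_ /eqP cA]]].
  rewrite sum_nat_const leq_mul2r; apply/orP; right.
  have <- : \sum_(A | ksub [set: 'I_m] A) \sum_(B | ksub (~: A) B) 1 = #|Q|.
    by rewrite pair_big_dep -sum1_card.
  rewrite (eq_bigr (fun=> 'C(m - k, k))) => [|A /andP[_ /eqP cA]].
    by rewrite sum_nat_const card_ksubT.
  by rewrite sum1_card card_ksubC cA.
move=> /andP[sB /eqP cB].
rewrite (@card_family_split _ _ [set u; v]%SET (fam (A, B)) 1 'C(m - 2 * k, k)).
- by rewrite exp1n mul1n card_ord cards2 uv.
- by move=> w ws; rewrite /fam ws card1.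
- move=> w /negbTE ws; rewrite /fam ws card_ksubC /=.
  suff -> : #|A :|: B| = 2 * k by [].
  move: sB; rewrite -finset.disjoints_subset disjoint_sym -(leq_card_setU _ _).2 => /eqP->.
  by rewrite cA cB; lia.
Qed.

(** A path from [v] to another node would start with an edge leaving [v]; [1 < n] provides the other
    node. *)
Lemma isolated_disconnected F v : 1 < n -> cut_off [set v]%SET F -> ~~ ig_connected F.
Proof.
move=> n1 /cut_offP cv; apply/negP => /forallP/(_ v)/forallP conn.
have [w wv] : exists w : 'I_n, w != v.
  apply/existsP; rewrite -negb_forall; apply/negP => /forallP all_v.
  have := card_ord n; suff : #|'I_n| <= 1 by lia.
  by apply/card_le1_eqP => a b _ _; rewrite (eqP (all_v a)) (eqP (all_v b)).
have := conn w; case/connectP => -[/= _ wv'|x p /= /andP[/andP[vx ne] _ _]].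
  by rewrite wv' eqxx in wv.
have := cv x; rewrite inE eq_sym vx colours1 => /(_ isT).
by rewrite -finset.disjoints_subset disjoint_sym -setI_eq0 (negbTE ne).
Qed.

End Counting.

Local Open Scope ring_scope.

(** * Probability that a set of nodes is not joined to the rest *)

Section Probability.
Variable R : realType.
Implicit Types (n m k s u : nat).

Lemma natr_bin_gt0 m k : (k <= m)%N -> 0 < ('C(m, k))%:R :> R.
Proof. by move=> le_km; rewrite ltr0n bin_gt0. Qed.

Lemma Prob_GE n m k (E : pred (colouring n m)) :
  Prob_G R n m k E = #|[pred F | admissible k F && E F]|%:R / ('C(m, k))%:R ^+ n.
Proof. by rewrite /Prob_G card_admissible natrX. Qed.

Lemma Prob_GC n m k (E : pred (colouring n m)) : (k <= m)%N ->
  Prob_G R n m k E = 1 - Prob_G R n m k (predC E).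
Proof.
move=> le_km; have C0 := lt0r_neq0 (exprn_gt0 n (natr_bin_gt0 le_km)).
apply/eqP; rewrite eq_sym subr_eq !Prob_GE -mulrDl -natrD.
have -> : (#|[pred F | admissible k F && E F]| +
   #|[pred F | admissible k F && predC E F]| = 'C(m, k) ^ n)%N.
  rewrite -card_admissible -[RHS](cardID E).
  by congr (_ + _)%N; apply: eq_card => F; rewrite !inE /= andbC.
by rewrite natrX divff.
Qed.

Lemma Prob_G_ge0 n m k (E : pred (colouring n m)) : 0 <= Prob_G R n m k E.
Proof. by rewrite Prob_GE divr_ge0 // exprn_ge0. Qed.

Lemma Prob_disconnected_le n m k :
  Prob_G R n m k (fun F => ~~ ig_connected F) <=
  \sum_(S : {set 'I_n} | (0 < #|S|)%N && (2 * #|S| <= n)%N) Prob_G R n m k (cut_off S).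
Proof.
rewrite Prob_GE; under eq_bigr do rewrite Prob_GE.
rewrite -mulr_suml -natr_sum ler_wpM2r ?invr_ge0 ?exprn_ge0 // ler_nat.
apply: (@card_union_bound _ _ _ _ (fun S => [pred F | admissible k F && cut_off S F])).
move=> F /andP[kF /ig_disconnected_cut[S [S0 Sn cS]]].
by exists S; rewrite ?S0 ?Sn //=; rewrite kF.
Qed.

Lemma bin_ratio_le u m k : (u <= m)%N -> (0 < m)%N -> (k <= m)%N ->
  ('C(u, k))%:R / ('C(m, k))%:R <= (u%:R / m%:R) ^+ k :> R.
Proof.
move=> le_um m0 le_km; rewrite expr_div_n ler_pdivrMr ?natr_bin_gt0 //.
rewrite mulrAC ler_pdivlMr ?exprn_gt0 ?ltr0n //.
rewrite -!natrX -!natrM ler_nat [X in (_ <= X)%N]mulnC; exact: bin_mul_expn_le.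
Qed.

(** Split on whether [S] uses at most [u] colours. Otherwise each of the n-s outer nodes avoids u+1
    colours with probability at most (1-(u+1)/m)^k, and 1-x <= exp(-x). *)
Lemma Prob_cut_off_le n m k (S : {set 'I_n}) u : (u < m)%N -> (k <= m)%N ->
  Prob_G R n m k (cut_off S) <=
  ('C(m, u))%:R * (u%:R / m%:R) ^+ (k * #|S|)
  + expR (- (u.+1%:R * k%:R * (n - #|S|)%:R / m%:R)).
Proof.
move=> lt_um le_km; have m0 : (0 < m)%N by lia.
have C0 := natr_bin_gt0 le_km; have Cn0 := exprn_gt0 n C0.
have Sn : (#|S| <= n)%N by rewrite -[X in (_ <= X)%N]card_ord max_card.
have m0R : 0 < m%:R :> R by rewrite ltr0n.
rewrite Prob_GE.
apply: (@le_trans _ _ ((('C(m, u))%:R * (('C(u, k))%:R ^+ #|S| * ('C(m, k))%:R ^+ (n - #|S|)) +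
  ('C(m, k))%:R ^+ #|S| * ('C(m - u.+1, k))%:R ^+ (n - #|S|)) / ('C(m, k))%:R ^+ n)).
  rewrite ler_wpM2r ?invr_ge0 ?(ltW Cn0) //.
  have := leq_add (card_small_colours k S (ltnW lt_um)) (card_cut_off m k S u).
  rewrite -(ler_nat R) [X in _ <= X]natrD !natrM !natrX => bnd. apply: le_trans bnd; rewrite ler_nat.
  rewrite -[X in (X <= _)%N](cardID [pred F : colouring n m | (#|colours F S| <= u)%N]).
  apply: leq_add; apply/subset_leq_card/fintype.subsetP => F.
    by rewrite !inE => /andP[/andP[-> _] ->].
  by rewrite !inE -ltnNge => /andP[-> /andP[-> ->]].
have Ce : ('C(m, k))%:R ^+ n = ('C(m, k))%:R ^+ #|S| * ('C(m, k))%:R ^+ (n - #|S|) :> R.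
  by rewrite -exprD subnKC.
have Cs0 := exprn_gt0 #|S| C0; have Cns0 := exprn_gt0 (n - #|S|) C0.
rewrite mulrDl; apply: lerD.
  have -> : ('C(m, u))%:R * (('C(u, k))%:R ^+ #|S| * ('C(m, k))%:R ^+ (n - #|S|))
    / ('C(m, k))%:R ^+ n = ('C(m, u))%:R * (('C(u, k))%:R / ('C(m, k))%:R) ^+ #|S| :> R.
    by rewrite Ce expr_div_n; field; rewrite !lt0r_neq0.
  rewrite ler_wpM2l // exprM lerXn2r ?nnegrE ?divr_ge0 ?exprn_ge0 ?divr_ge0 //.
  by apply: bin_ratio_le => //; apply: ltnW.
have -> : ('C(m, k))%:R ^+ #|S| * ('C(m - u.+1, k))%:R ^+ (n - #|S|)
    / ('C(m, k))%:R ^+ n = (('C(m - u.+1, k))%:R / ('C(m, k))%:R) ^+ (n - #|S|) :> R.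
  by rewrite Ce expr_div_n; field; rewrite !lt0r_neq0.
have -> : - (u.+1%:R * k%:R * (n - #|S|)%:R / m%:R) =
   (n - #|S|)%:R * (k%:R * (- (u.+1%:R / m%:R))) :> R by field; rewrite lt0r_neq0.
rewrite expRM_natl lerXn2r ?nnegrE ?divr_ge0 ?expR_ge0 //.
apply: le_trans (bin_ratio_le _ _ _) _ => //; first exact: leq_subr.
rewrite expRM_natl lerXn2r ?nnegrE ?divr_ge0 ?expR_ge0 //.
apply: le_trans (expR_ge1Dx _).
by rewrite natrB // mulrBl divff ?lt0r_neq0.
Qed.

Lemma sum_geometric_le (q : R) n : 0 <= q -> q <= 2^-1 ->
  \sum_(i < n) q ^+ i.+1 <= 2 * q.
Proof.
move=> q0 q1.
have -> : \sum_(i < n) q ^+ i.+1 = q * \sum_(i < n) q ^+ i.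
  by rewrite mulr_sumr; apply: eq_bigr => i _; rewrite exprS.
rewrite mulrC ler_wpM2r //.
have := subrX1 q n; have := exprn_ge0 n q0.
set s := \sum_(i < n) _ => qn0 e.
have s0 : 0 <= s by apply: sumr_ge0 => i _; rewrite exprn_ge0.
nra.
Qed.

(** The C(n,s) sets of size s contribute at most 2 exp(-Ks) together; the geometric series has ratio
    at most 1/2 because [1 <= K]. *)
Lemma Prob_disconnected_geometric n m k (K : R) : 1 <= K ->
  (forall S : {set 'I_n}, (0 < #|S|)%N -> (2 * #|S| <= n)%N ->
    ('C(n, #|S|))%:R * Prob_G R n m k (cut_off S) <= 2 * expR (- K) ^+ #|S|) ->
  Prob_G R n m k (fun F => ~~ ig_connected F) <= 4 * expR (- K).
Proof.
move=> K1 bound; apply: le_trans (Prob_disconnected_le n m k) _.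
have q0 : 0 <= expR (- K) by rewrite expR_ge0.
have q1 : expR (- K) <= 2^-1.
  rewrite expRN lef_pV2 ?posrE ?expR_gt0 //.
  by apply: le_trans (expR_ge1Dx _); lra.
have n0 S : (0 < #|S : {set 'I_n}|)%N -> (#|S|.-1 < n)%N.
  by have := max_card S; rewrite card_ord; lia.
apply: (@le_trans _ _ (\sum_(S : {set 'I_n} | (0 < #|S|)%N)
    2 * expR (- K) ^+ #|S| / ('C(n, #|S|))%:R)).
  (* The restriction to sets of at most n/2 nodes is dropped by adding nonnegative terms. *)
  rewrite [X in _ <= X](bigID (fun S : {set 'I_n} => 2 * #|S| <= n)%N) /=.
  rewrite -[X in X <= _]addr0; apply: lerD; last first.
    by apply: sumr_ge0 => S _; rewrite divr_ge0 // mulr_ge0 // exprn_ge0.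
  apply: ler_sum => S /andP[S0 Sn]; rewrite ler_pdivlMr; first by rewrite mulrC bound.
  by rewrite natr_bin_gt0 //; have := n0 _ S0; lia.
case: n n0 {bound} => [|n] n0.
  by rewrite big_pred0 ?mulr_ge0 // => S; have := max_card S; rewrite card_ord; lia.
(* Size s is indexed by the ordinal s-1; [inord] needs a nonempty ordinal type, hence the separate
   case n = 0. *)
rewrite (partition_big (fun S : {set 'I_n.+1} => inord #|S|.-1 : 'I_n.+1) xpredT) //=.
have -> : 4 * expR (- K) = 2 * (2 * expR (- K)) by ring.
apply: le_trans (ler_wpM2l _ (sum_geometric_le n.+1 q0 q1)) => //; rewrite mulr_sumr.
apply: ler_sum => i _.
have inE' (S : {set 'I_n.+1}) : (0 < #|S|)%N && (inord #|S|.-1 == i) = (#|S| == i.+1).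
  apply/andP/eqP => [[S0 /eqP <-]|Si]; first by rewrite inordK ?n0 // prednK.
  by split; [lia | rewrite Si /= inord_val].
rewrite (eq_bigl _ _ inE').
rewrite (eq_bigr (fun=> 2 * expR (- K) ^+ i.+1 / ('C(n.+1, i.+1))%:R)) => [|S /eqP -> //].
rewrite sumr_const -[X in X <= _]mulr_natr.
have -> : #|[pred S : {set 'I_n.+1} | #|S| == i.+1]| = 'C(n.+1, i.+1).
  by rewrite -[X in 'C(X, _)]card_ord -card_draws cardsE.
by rewrite divfK // lt0r_neq0 // natr_bin_gt0 // ltn_ord.
Qed.

End Probability.

(** * Exponential estimates for the union bound *)

Section Estimates.
Variable R : realType.
Implicit Types (n m k s u : nat).

(** C(m,u) t^u is one term of (1+t)^m <= exp(tm); the parameter [t] is tuned at each use. *)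
Lemma bin_le_expR (t : R) m u : 0 < t ->
  ('C(m, u))%:R <= expR (t * m%:R - u%:R * ln t).
Proof.
move=> t0; rewrite expRB expRM_natr expRM_natl lnK ?posrE //.
rewrite ler_pdivlMr ?exprn_gt0 //.
apply: (@le_trans _ _ ((1 + t) ^+ m)); last first.
  by rewrite lerXn2r ?nnegrE ?expR_ge0 ?expR_ge1Dx //; lra.
have [lt_mu|le_um] := ltnP m u.
  by rewrite bin_small // mul0r exprn_ge0 //; lra.
rewrite exprDn (bigD1 (Ordinal (le_um : u < m.+1)%N)) //= expr1n mul1r mulr_natl lerDl.
by apply: sumr_ge0 => i _; rewrite mulrn_wge0 // mulr_ge0 // exprn_ge0 // ltW.
Qed.

Lemma bin_le_expR_size n s : ('C(n, s))%:R <= expR n%:R :> R.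
Proof.
by have := bin_le_expR n s (@ltr01 R); rewrite mul1r ln1 mulr0 subr0.
Qed.

(** The choice t = s/n gives the familiar bound (en/s)^s. *)
Lemma bin_le_expR_ratio n s : (0 < s)%N -> (s <= n)%N ->
  ('C(n, s))%:R <= expR (s%:R * (1 - ln (s%:R / n%:R))) :> R.
Proof.
move=> s0 sn; have sR : 0 < s%:R :> R by rewrite ltr0n.
have nR : 0 < n%:R :> R by rewrite ltr0n (leq_trans s0).
have := bin_le_expR n s (divr_gt0 sR nR).
by rewrite divfK ?lt0r_neq0 // mulrBr mulr1.
Qed.

(** With y = ks/m, C(m,u) costs about y^(-u) while (u/m)^(ks) <= y^(ks). Since u <= (1-eps)ks, a
    gain of y^(eps ks) remains, which absorbs all other factors. *)
Lemma sparse_small_union n m k s u (eps K : R) :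
  (0 < k)%N -> (0 < s)%N -> (s <= n)%N -> (n <= m)%N -> 0 < eps -> 1 <= K ->
  2 <= eps * k%:R -> u%:R <= (1 - eps) * (k%:R * s%:R) ->
  4 * (K + 1) <= eps * - ln (k%:R * s%:R / m%:R) ->
  ('C(n, s))%:R * (('C(m, u))%:R * (u%:R / m%:R) ^+ (k * s)) <= expR (- K) ^+ s.
Proof.
move=> k0 s0 sn nm; have n0 : (0 < n)%N by lia.
have m0 : (0 < m)%N by lia.
move=> e0 K1 ek hu hL.
have sR : 0 < s%:R :> R by rewrite ltr0n.
have kR : 1 <= k%:R :> R by rewrite ler1n.
have nR : 0 < n%:R :> R by rewrite ltr0n.
have mR : 0 < m%:R :> R by rewrite ltr0n.
have nmR : n%:R <= m%:R :> R by rewrite ler_nat.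
have uR : 0 <= u%:R :> R by [].
have k0R : 0 < k%:R :> R by lra.
have y0 : 0 < k%:R * s%:R / m%:R :> R by rewrite divr_gt0 // mulr_gt0.
set y := k%:R * s%:R / m%:R in hL y0 *.
have L0 : 0 < - ln y by rewrite -(pmulr_rgt0 _ e0); lra.
(* Uses n <= m and ln k <= k to express the bound through y. *)
have h1 : ('C(n, s))%:R <= expR (s%:R * (1 - ln y + k%:R)).
  apply: le_trans (bin_le_expR_ratio s0 sn) _; rewrite ler_expR ler_pM2l //.
  suff : ln y - k%:R <= ln (s%:R / n%:R) by lra.
  have : ln (s%:R / m%:R) <= ln (s%:R / n%:R) :> R.
    by rewrite ler_ln ?posrE ?divr_gt0 // ler_pM2l // lef_pV2 ?posrE.
  have -> : y = k%:R * (s%:R / m%:R) by rewrite /y mulrA.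
  rewrite [ln (k%:R * _)]lnM ?posrE ?divr_gt0 //=.
  by have := ln_sublinear k0R; lra.
have h2 : ('C(m, u))%:R <= expR (k%:R * s%:R - u%:R * ln y).
  by have := bin_le_expR m u y0; rewrite {1}/y divfK // lt0r_neq0.
have h3 : (u%:R / m%:R) ^+ (k * s) <= expR (k%:R * s%:R * ln y).
  rewrite -natrM expRM_natl lnK ?posrE // lerXn2r ?nnegrE ?divr_ge0 ?(ltW y0) //.
  rewrite ler_pM2r ?invr_gt0 //; apply: le_trans hu _.
  by have := mulr_gt0 k0R sR; nra.
have pos : 0 <= (u%:R / m%:R) ^+ (k * s) :> R by rewrite exprn_ge0 // divr_ge0.
apply: le_trans (ler_pM _ _ h1 (ler_pM _ _ h2 h3)) _; rewrite ?mulr_ge0 //.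
rewrite -!expRD -expRM_natl ler_expR.
set L := ln y in hL L0 *; clearbody L y.
have : u%:R * - L <= (1 - eps) * (k%:R * s%:R) * - L by rewrite ler_wpM2r // ltW.
move=> hu'.
(* Half of the right-hand side pays for -L because eps k >= 2; the other half pays for 1 + 2k + K by
   the assumption on L. *)
have key : 1 - L + 2 * k%:R + K <= eps * - L * k%:R.
  have a1 : 2 * - L <= eps * k%:R * - L by rewrite ler_wpM2r // ltW.
  have a2 : 4 * (K + 1) * k%:R <= eps * - L * k%:R by rewrite ler_wpM2r.
  have a3 : K + 1 <= (K + 1) * k%:R by rewrite ler_peMr //; lra.
  have a4 : k%:R <= K * k%:R by rewrite ler_peMl //; lra.
  lra.
have : s%:R * (1 - L + 2 * k%:R + K) <= s%:R * (eps * - L * k%:R) by rewrite ler_wpM2l // ltW.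
lra.
Qed.

(** The lower bounds on u+1 and on k^2 n make the escape exponent at least s (1-eps) c ln n (1 -
    s/n), to be set against (en/s)^s. *)
Lemma sparse_escape n m k s u (eps K c : R) :
  (0 < m)%N -> (0 < s)%N -> (2 * s <= n)%N -> 0 < eps -> eps < 1 -> 0 < c ->
  (1 - eps) * (k%:R * s%:R) <= u.+1%:R ->
  c * (m%:R * ln n%:R) <= k%:R ^+ 2 * n%:R ->
  K + 1 + ln n%:R <= (1 - eps) ^+ 2 * c * ln n%:R ->
  K + 1 - ln eps <= (1 - eps) / 2 * c * ln n%:R ->
  ('C(n, s))%:R * expR (- (u.+1%:R * k%:R * (n - s)%:R / m%:R)) <= expR (- K) ^+ s.
Proof.
move=> m0 s0 sn; have n0 : (0 < n)%N by lia.
have le_sn : (s <= n)%N by lia.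
move=> e0 e1 c0 hu hc hK1 hK2.
have sR : 1 <= s%:R :> R by rewrite ler1n.
have s0R : 0 < s%:R :> R by lra.
have nR : 0 < n%:R :> R by rewrite ltr0n.
have n1R : 1 <= n%:R :> R by rewrite ler1n.
have mR : 0 < m%:R :> R by rewrite ltr0n.
have l0 : 0 <= ln (n%:R : R) by rewrite ln_ge0.
have ns : (n - s)%:R = n%:R - s%:R :> R by rewrite natrB.
have sn2 : 2 * s%:R <= n%:R :> R by rewrite -natrM ler_nat.
have E1 : s%:R * ((1 - eps) * c * ln n%:R * (1 - s%:R / n%:R))
     <= u.+1%:R * k%:R * (n - s)%:R / m%:R.
  rewrite ler_pdivlMr // ns.
  have -> : 1 - s%:R / n%:R = (n%:R - s%:R) / n%:R :> R by field; rewrite lt0r_neq0.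
  rewrite !mulrA mulrAC ler_pdivrMr //.
  have a1 : (1 - eps) * (k%:R * s%:R) * (k%:R * (n%:R - s%:R) * n%:R)
    <= u.+1%:R * (k%:R * (n%:R - s%:R) * n%:R).
    by rewrite ler_wpM2r // !mulr_ge0 //; lra.
  have a2 : (1 - eps) * s%:R * (n%:R - s%:R) * (c * (m%:R * ln n%:R))
    <= (1 - eps) * s%:R * (n%:R - s%:R) * (k%:R ^+ 2 * n%:R).
    by rewrite ler_wpM2l // !mulr_ge0 //; lra.
  lra.
apply: (@le_trans _ _ (expR (s%:R * (1 - ln (s%:R / n%:R))) *
    expR (- (s%:R * ((1 - eps) * c * ln n%:R * (1 - s%:R / n%:R)))))).
  apply: ler_pM => //; rewrite ?expR_ge0 //; last by rewrite ler_expR lerN2.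
  exact: bin_le_expR_ratio.
rewrite -expRD -expRM_natl ler_expR -mulrN -mulrDr ler_pM2l //.
have x2 : s%:R / n%:R <= 2^-1 :> R by rewrite ler_pdivrMr //; lra.
have A0 : 0 <= (1 - eps) * c * ln n%:R by rewrite !mulr_ge0 //; lra.
(* For s/n <= eps, -ln(s/n) can reach ln n, so a coefficient above 1 is needed ([hK1]); beyond eps
   it is at most -ln eps, and 1 - s/n >= 1/2 suffices ([hK2]). *)
have [small|large] := leP (s%:R / n%:R) eps.
  have : - ln (s%:R / n%:R) <= ln (n%:R : R).
    rewrite ln_div ?posrE //=; have := ln_ge0 sR; lra.
  have : (1 - eps) * c * ln n%:R * (1 - eps) <= (1 - eps) * c * ln n%:R * (1 - s%:R / n%:R).
    by rewrite ler_wpM2l //; lra.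
  lra.
have : ln eps <= ln (s%:R / n%:R) by rewrite ler_ln ?posrE ?divr_gt0 // ltW.
have : (1 - eps) * c * ln n%:R * 2^-1 <= (1 - eps) * c * ln n%:R * (1 - s%:R / n%:R).
  by rewrite ler_wpM2l //; lra.
lra.
Qed.

(** Both binomials are at most exp(m), while (u/m)^(ks) <= exp(-Ddm) <= exp(-(K+2)m). *)
Lemma dense_small_union n m k s u (d D K : R) :
  (s <= n)%N -> (n <= m)%N -> (0 < m)%N -> 0 <= K -> 0 <= D ->
  u%:R <= expR (- D) * m%:R -> d * m%:R <= k%:R * s%:R -> K + 2 <= D * d ->
  ('C(n, s))%:R * (('C(m, u))%:R * (u%:R / m%:R) ^+ (k * s)) <= expR (- K) ^+ s.
Proof.
move=> sn nm m0; have sm := leq_trans sn nm; move=> K0 D0 hu hd hD.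
have mR : 0 < m%:R :> R by rewrite ltr0n.
have nmR : n%:R <= m%:R :> R by rewrite ler_nat.
have smR : s%:R <= m%:R :> R by rewrite ler_nat.
have h3 : (u%:R / m%:R) ^+ (k * s) <= expR (k%:R * s%:R * - D).
  rewrite -natrM expRM_natl lerXn2r ?nnegrE ?divr_ge0 ?expR_ge0 //.
  by rewrite ler_pdivrMr.
have pos : 0 <= (u%:R / m%:R) ^+ (k * s) :> R by rewrite exprn_ge0 // divr_ge0.
apply: le_trans (ler_pM _ _ (bin_le_expR_size n s) (ler_pM _ _ (bin_le_expR_size m u) h3)) _; rewrite ?mulr_ge0 //.
rewrite -!expRD -expRM_natl ler_expR.
have : D * (d * m%:R) <= D * (k%:R * s%:R) by rewrite ler_wpM2l.
have : (K + 2) * m%:R <= D * d * m%:R by rewrite ler_wpM2r // ltW.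
have : K * s%:R <= K * m%:R by rewrite ler_wpM2l.
lra.
Qed.

(** As n-s >= n/2, the escape exponent is at least (K+1)n; the binomial costs only n. *)
Lemma dense_escape n m k s u (d K : R) :
  (2 * s <= n)%N -> (0 < m)%N -> 0 <= K -> d * m%:R <= u.+1%:R ->
  2 * (K + 1) <= d * k%:R ->
  ('C(n, s))%:R * expR (- (u.+1%:R * k%:R * (n - s)%:R / m%:R)) <= expR (- K) ^+ s.
Proof.
move=> sn m0; have le_sn : (s <= n)%N by lia.
have le_ns : (n <= 2 * (n - s))%N by lia.
move=> K0 hd hk.
have mR : 0 < m%:R :> R by rewrite ltr0n.
have ns : n%:R <= 2 * (n - s)%:R :> R by rewrite -natrM ler_nat.
have snR : s%:R <= n%:R :> R by rewrite ler_nat.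
have nR : 0 <= n%:R :> R by [].
apply: le_trans (ler_wpM2r (expR_ge0 _) (bin_le_expR_size n s)) _.
rewrite -!expRD -expRM_natl ler_expR.
have E : d * k%:R * (n - s)%:R <= u.+1%:R * k%:R * (n - s)%:R / m%:R.
  rewrite ler_pdivlMr //.
  have : d * m%:R * (k%:R * (n - s)%:R) <= u.+1%:R * (k%:R * (n - s)%:R).
    by rewrite ler_wpM2r // mulr_ge0.
  lra.
have : 2 * (K + 1) * (n - s)%:R <= d * k%:R * (n - s)%:R by rewrite ler_wpM2r.
have : (K + 1) * n%:R <= (K + 1) * (2 * (n - s)%:R) by rewrite ler_wpM2l //; lra.
have : K * s%:R <= K * n%:R by rewrite ler_wpM2l.
lra.
Qed.

End Estimates.

(** * From limits to eventual bounds; small probability of disconnection *)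

Section Limits.
Variable R : realType.

(** The limsup is an infimum of suprema over neighbourhoods of infinity; a supremum below [a] serves
    as [c], being finite since it also bounds a value of [u]. *)
Lemma limn_esup_lt (u : nat -> R) (a : R) :
  (limn_esup (fun n => (u n)%:E) < a%:E)%E ->
  exists2 c, c < a & exists N, forall n, (N <= n)%N -> u n <= c.
Proof.
move=> /ereal_inf_lt[_ [V [N _ VN] <-]] lt_a.
have ub n : (N <= n)%N -> ((u n)%:E <= ereal_sup ((fun n => (u n)%:E) @` V)%classic)%E.
  by move=> le_Nn; apply: ereal_sup_ubound; exists n => //; apply: VN.
have := ub N (leqnn N); move: lt_a ub; case: (ereal_sup _) => [c| |] // lt_c ub _.
by exists c; [rewrite -lte_fin | exists N => n /ub; rewrite lee_fin].
Qed.

Lemma limn_einf_gt (u : nat -> R) (a : R) :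
  (a%:E < limn_einf (fun n => (u n)%:E))%E ->
  exists2 c, a < c & exists N, forall n, (N <= n)%N -> c <= u n.
Proof.
rewrite lteNr => /(@limn_esup_lt (fun n => - u n) (- a))[c ca [N cN]].
by exists (- c); [lra | exists N => n /cN; lra].
Qed.

Lemma ln_natr_unbounded (A : R) : exists N, forall n, (N <= n)%N -> A <= ln n%:R :> R.
Proof.
exists (Num.truncn (expR A)).+1 => n le_n.
have := truncnS_gt (expR A); move: le_n; rewrite -(ler_nat R) => le_n lt_A.
have lt_An := lt_le_trans lt_A le_n.
rewrite -[A]expRK ler_ln ?posrE ?expR_gt0 ?(ltW lt_An) //.
exact: lt_trans (expR_gt0 A) lt_An.
Qed.

Lemma Prob_disconnected_small (k m : nat -> nat) (c : R) (N : nat) :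
  (forall n, (0 < k n)%N /\ (k n <= m n)%N) -> (forall n, (n <= m n)%N) -> 1 < c ->
  (forall n, (N <= n)%N -> c <= kkn_ratio R k m n) ->
  forall K : R, 1 <= K -> exists N', forall n, (N' <= n)%N ->
  Prob_G R n (m n) (k n) (fun F => ~~ ig_connected F) <= 4 * expR (- K).
Proof.
move=> hk hm c1 hc K K1.
(* Chosen so that (1-eps)^2 c still exceeds 1, by the amount [eta]. *)
pose eps : R := (c - 1) / (2 * c).
have e0 : 0 < eps by rewrite divr_gt0 //; lra.
have e1 : eps < 1 by rewrite ltr_pdivrMr; lra.
have ec : (1 - eps) ^+ 2 * c = 1 + (c - 1) ^+ 2 / (4 * c).
  by rewrite /eps; field; rewrite lt0r_neq0 //; lra.
pose eta : R := (c - 1) ^+ 2 / (4 * c).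
have eta0 : 0 < eta by rewrite divr_gt0 ?exprn_gt0 //; lra.
(* [d] separates sparse (ks < dm) from dense; it makes -ln(ks/m) large enough in the sparse case.
   [D] then makes Dd = K+2, and d'm is the dense colour threshold. *)
pose d : R := expR (- (4 * (K + 1) / eps)).
pose D : R := (K + 2) / d.
pose d' : R := expR (- D).
have d0 : 0 < d by exact: expR_gt0.
have d1 : d < 1.
  by rewrite /d expR_lt1 oppr_lt0 divr_gt0 //; lra.
have D0 : 0 < D by rewrite divr_gt0 //; lra.
have d'0 : 0 < d' by exact: expR_gt0.
have d'1 : d' < 1 by rewrite /d' expR_lt1 oppr_lt0.
pose k0 : R := 2 / eps + 2 * (K + 1) / d'.
have k00 : 0 < k0 by rewrite addr_gt0 // divr_gt0 //; lra.
have e2 : 0 < (1 - eps) / 2 * c by rewrite !mulr_gt0 //; lra.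
(* All summands are nonnegative, so [A <= ln n] yields every required lower bound on ln n at
   once. *)
pose A : R := 1 + k0 ^+ 2 + (K + 1) / eta + `|(K + 1 - ln eps) / ((1 - eps) / 2 * c)|.
have [N1 hN1] := ln_natr_unbounded A.
exists (maxn N N1).+1 => n le_n.
have n0 : (0 < n)%N := leq_trans (ltn0Sn _) le_n.
move: (ltnW le_n); rewrite geq_max => /andP[/hc {}hc /hN1 {}hN1].
have [kn0 knm] := hk n; have nm := hm n.
have m0 : (0 < m n)%N := leq_trans kn0 knm.
have p1 : 0 <= k0 ^+ 2 by rewrite exprn_ge0 // ltW.
have p2 : 0 <= (K + 1) / eta by rewrite divr_ge0 ?(ltW eta0) //; lra.
have p3 : 0 <= `|(K + 1 - ln eps) / ((1 - eps) / 2 * c)| by [].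
have l0 : 0 < ln n%:R :> R by apply: lt_le_trans hN1; rewrite /A; lra.
have mR : 0 < (m n)%:R :> R by rewrite ltr0n.
have nR : 0 < n%:R :> R by rewrite ltr0n.
have nmR : n%:R <= (m n)%:R :> R by rewrite ler_nat.
have {}hc : c * ((m n)%:R * ln n%:R) <= (k n)%:R ^+ 2 * n%:R :> R.
  by move: hc; rewrite /kkn_ratio ler_pdivlMr // mulr_gt0.
(* From k^2 n >= c m ln n >= n ln n follows k^2 >= ln n >= k0^2; this is where m >= n forces k to
   grow. *)
have kk : k0 <= (k n)%:R.
  rewrite -(@ler_pXn2r _ 2) ?nnegrE ?(ltW k00) //.
  have : k0 ^+ 2 <= ln n%:R by apply: le_trans hN1; rewrite /A; lra.
  have : 1 * (n%:R * ln n%:R) <= c * ((m n)%:R * ln n%:R) :> R.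
    apply: ler_pM => //; first by rewrite mulr_ge0 // ltW.
      exact: ltW.
    by rewrite ler_pM2r.
  rewrite mul1r => h1 h2; rewrite -(ler_pM2r nR).
  apply: le_trans hc; apply: le_trans h1; rewrite mulrC ler_pM2l //.
have kk1 : 2 <= eps * (k n)%:R.
  rewrite mulrC -ler_pdivrMr //; apply: le_trans kk.
  by rewrite lerDl divr_ge0 ?(ltW d'0) //; lra.
have kk2 : 2 * (K + 1) <= d' * (k n)%:R.
  rewrite [d' * _]mulrC -ler_pdivrMr //; apply: le_trans kk.
  by rewrite lerDr divr_ge0 ?(ltW e0) //; lra.
have hK1 : K + 1 + ln n%:R <= (1 - eps) ^+ 2 * c * ln n%:R.
  rewrite ec -/eta mulrDl mul1r addrC lerD2l [eta * _]mulrC -ler_pdivrMr //.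
  by apply: le_trans hN1; rewrite /A; lra.
have hK2 : K + 1 - ln eps <= (1 - eps) / 2 * c * ln n%:R.
  rewrite [_ * ln _]mulrC -ler_pdivrMr //; apply: le_trans (ler_norm _) _.
  by apply: le_trans hN1; rewrite /A; lra.
apply: Prob_disconnected_geometric => // S S0 Sn.
set s := #|S| in S0 Sn *.
have sn : (s <= n)%N by move: Sn; rewrite mul2n -addnn; apply: leq_trans; apply: leq_addr.
suff [u lt_um [b1 b2]] : exists2 u, (u < m n)%N &
   ('C(n, s))%:R * (('C(m n, u))%:R * (u%:R / (m n)%:R) ^+ (k n * s)) <= expR (- K) ^+ s /\
   ('C(n, s))%:R * expR (- (u.+1%:R * (k n)%:R * (n - s)%:R / (m n)%:R)) <= expR (- K) ^+ s.
  apply: le_trans (ler_wpM2l _ (Prob_cut_off_le R S lt_um knm)) _ => //.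
  by rewrite mulrDr -/s; lra.
have s0R : 0 < s%:R :> R by rewrite ltr0n.
have k0R : 0 < (k n)%:R :> R by rewrite ltr0n.
have ks0 : 0 < (k n)%:R * s%:R :> R by rewrite mulr_gt0.
have [sparse|dense] := ltP ((k n)%:R * s%:R) (d * (m n)%:R).
  have x0 : 0 <= (1 - eps) * ((k n)%:R * s%:R) by rewrite mulr_ge0 ?(ltW ks0) //; lra.
  have /andP[u1 u2] := truncn_itv x0.
  (* The integer part gives u <= (1-eps)ks < u+1, the two bounds the sparse estimates need. *)
  exists (Num.truncn ((1 - eps) * ((k n)%:R * s%:R))).
    rewrite -(ltr_nat R); apply: le_lt_trans u1 _; apply: lt_trans (_ : d * (m n)%:R < _).
      by apply: le_lt_trans sparse; rewrite ler_piMl ?(ltW ks0) //; lra.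
    by rewrite gtr_pMl.
  split; last first.
    by apply: (@sparse_escape _ _ _ _ _ _ eps _ c) => //; [lra | exact: ltW].
  apply: (@sparse_small_union _ _ _ _ _ _ eps) => //.
  rewrite [eps * _]mulrC -ler_pdivrMr // lerNr -ler_expR lnK ?posrE ?divr_gt0 //.
  by rewrite ler_pdivrMr // ltW.
have x0 : 0 <= d' * (m n)%:R by rewrite mulr_ge0 // ltW.
have /andP[u1 u2] := truncn_itv x0.
exists (Num.truncn (d' * (m n)%:R)).
  by rewrite -(ltr_nat R); apply: le_lt_trans u1 _; rewrite gtr_pMl.
split.
  apply: (@dense_small_union _ _ _ _ _ _ d D) => //; rewrite ?(ltW D0) //; first lra.
  by rewrite /D divfK // lt0r_neq0.
by apply: (@dense_escape _ _ _ _ _ _ d') => //; [lra | exact: ltW].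
Qed.

End Limits.

(** * Isolated nodes *)

Section SecondMoment.
Variable R : realType.

(** Chebyshev's argument without division: the right-hand side is the sum of (M X - S1)^2 over [P],
    and each point where no [E i] holds contributes S1^2. *)
Lemma second_moment (T I : finType) (P : pred T) (E : I -> pred T) (M S1 S2 : R) :
  M = #|P|%:R -> S1 = \sum_i #|[pred x | P x && E i x]|%:R ->
  S2 = \sum_i \sum_j #|[pred x | [&& P x, E i x & E j x]]|%:R ->
  #|[pred x | P x && [forall i, ~~ E i x]]|%:R * S1 ^+ 2 <= M * (M * S2 - S1 ^+ 2).
Proof.
move=> eM eS1 eS2; pose X x : R := \sum_i (E i x)%:R.
have cardE (Q : pred T) : #|[pred x | P x && Q x]|%:R = \sum_(x | P x) (Q x)%:R :> R.
  rewrite -sum1_card natr_sum big_mkcondr /=.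
  by apply: eq_bigr => x _; case: (Q x).
have sX : \sum_(x | P x) X x = S1.
  by rewrite exchange_big eS1; apply: eq_bigr => i _; rewrite cardE.
have sX2 : \sum_(x | P x) X x ^+ 2 = S2.
  rewrite eS2; under [RHS]eq_bigr do under eq_bigr do rewrite (cardE (fun x => E _ x && E _ x)).
  under [RHS]eq_bigr do rewrite exchange_big /=.
  rewrite [RHS]exchange_big; apply: eq_bigr => x _.
  rewrite expr2 mulr_suml; apply: eq_bigr => i _; rewrite mulr_sumr.
  by apply: eq_bigr => j _; rewrite -natrM mulnb.
have -> : M * (M * S2 - S1 ^+ 2) = \sum_(x | P x) (M * X x - S1) ^+ 2.
  under eq_bigr do rewrite sqrrB exprMn.
  rewrite big_split sumrB /= -mulr_sumr sX2 sumr_const -mulr_natr.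
  rewrite -[#|P|%:R]eM.
  have -> : \sum_(x | P x) M * X x * S1 *+ 2 = M * S1 * S1 *+ 2.
    by rewrite sumrMnl -mulr_suml -mulr_sumr sX.
  ring.
rewrite cardE mulr_suml; apply: ler_sum => x _.
case: (boolP [forall i, ~~ E i x]) => [/forallP none|_]; last by rewrite mul0r sqr_ge0.
have -> : X x = 0 by apply: big1 => i _; rewrite (negbTE (none i)).
by rewrite mulr0 sub0r sqrrN mul1r.
Qed.

(** Connectedness excludes isolated nodes. In the second moment, the diagonal yields 1/(n a^(n-1)),
    and log-concavity bounds the off-diagonal part by 1/a. *)
Lemma Prob_connected_second_moment n m k : (1 < n)%N -> (0 < k)%N -> (k <= m)%N ->
  (0 < 'C(m - k, k))%N ->
  forall a : R, a = ('C(m - k, k))%:R / ('C(m, k))%:R ->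
  Prob_G R n m k (fun F => ig_connected F) <= (n%:R * a ^+ n.-1)^-1 + a^-1 - 1.
Proof.
move=> n1 k0 le_km A0 a; pose A := 'C(m - k, k); pose C := 'C(m, k).
rewrite -/A -/C in A0 * => aE.
have C0 : (0 < C)%N by rewrite bin_gt0.
pose S1 : R := \sum_(i : 'I_n) #|[pred F : colouring n m | admissible k F && cut_off [set i]%SET F]|%:R.
pose S2 : R := \sum_(i : 'I_n) \sum_(j : 'I_n) #|[pred F : colouring n m |
  [&& admissible k F, cut_off [set i]%SET F & cut_off [set j]%SET F]]|%:R.
have := @second_moment _ _ [pred F : colouring n m | admissible k F]
  (fun i => cut_off [set i]%SET) _ S1 S2 erefl erefl erefl.
rewrite card_admissible -/C /=.
have eS1 : S1 = n%:R * (C%:R * A%:R ^+ n.-1).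
  rewrite /S1; under eq_bigr do rewrite card_isolated -/A -/C natrM natrX.
  by rewrite sumr_const card_ord [RHS]mulr_natl.
pose B := 'C(m - 2 * k, k).
have q2 : (C ^ n * (C * A * B ^ (n - 2)) * A <= C * (C * A ^ n.-1) ^ 2)%N.
  (* If 2k > m, truncated subtraction makes [B] the binomial C(0,k), which vanishes since k > 0. *)
  have BC : (B * C <= A ^ 2)%N.
    have [le|gt] := leqP (2 * k) m.
      have := bin_log_concave (m - 2 * k) k k.
      have -> : (m - 2 * k + 2 * k = m)%N by lia.
      by have -> : (m - 2 * k + k = m - k)%N by lia.
    by rewrite /B (_ : m - 2 * k = 0)%N ?bin0n; [case: (k) k0 | lia].
  have {}BC : ((B * C) ^ (n - 2) <= (A ^ 2) ^ (n - 2))%N.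
    by case: (n - 2)%N => // e; rewrite leq_exp2r.
  have -> : (n.-1 = (n - 2).+1)%N by lia.
  have -> : (C ^ n = C ^ (n - 2) * C ^ 2)%N by rewrite -expnD; congr (_ ^ _)%N; lia.
  rewrite [(A ^ _.+1)%N]expnS !expnMn.
  have sq : ((A ^ 2) ^ (n - 2) = (A ^ (n - 2)) ^ 2)%N by rewrite -!expnM mulnC.
  rewrite expnMn sq in BC.
  by have := leq_mul (leqnn (C ^ 3 * A ^ 2)) BC; congr (_ <= _)%N; ring.
have MR : 0 < (C ^ n)%:R :> R by rewrite ltr0n expn_gt0 C0.
have CR : 0 < C%:R :> R by rewrite ltr0n.
have AR : 0 < A%:R :> R by rewrite ltr0n.
have nR : 0 < n%:R :> R by rewrite ltr0n (ltn_trans _ n1).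
have An0 : 0 < A%:R ^+ n.-1 :> R by rewrite exprn_gt0.
have Cn0 : 0 < C%:R ^+ n.-1 :> R by rewrite exprn_gt0.
have S10 : 0 < S1 by rewrite eS1 !mulr_gt0.
have S2le : S2 <= S1 + n%:R * (n%:R * (C * A * B ^ (n - 2))%:R).
  have -> : S1 + n%:R * (n%:R * (C * A * B ^ (n - 2))%:R) =
      \sum_(i : 'I_n) (#|[pred F : colouring n m | admissible k F && cut_off [set i]%SET F]|%:R
        + n%:R * (C * A * B ^ (n - 2))%:R).
    by rewrite big_split sumr_const card_ord /= mulr_natl.
  apply: ler_sum => i _; rewrite (bigD1 i) //=; apply: lerD.
    by rewrite ler_nat; apply/subset_leq_card/fintype.subsetP => F; rewrite !inE => /and3P[-> ->].
  apply: (@le_trans _ _ (\sum_(j | j != i) (C * A * B ^ (n - 2))%:R)).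
    by apply: ler_sum => j ji; rewrite ler_nat card_isolated_pair // eq_sym.
  rewrite sumr_const -[X in X <= _]mulr_natl ler_wpM2r // ler_nat -[X in (_ <= X)%N]card_ord; exact: max_card.
move=> sm.
have MS2 : (C ^ n)%:R * S2 <= S1 ^+ 2 * ((n%:R * a ^+ n.-1)^-1 + a^-1).
  apply: le_trans (ler_wpM2l (ltW MR) S2le) _; rewrite !mulrDr; apply: lerD.
    have Cn : (C ^ n)%:R = C%:R * C%:R ^+ n.-1 :> R.
      by rewrite natrX -exprS prednK // (ltn_trans _ n1).
    rewrite Cn eS1 aE expr_div_n -/C le_eqVlt; apply/orP; left; apply/eqP.
    by field; rewrite !lt0r_neq0.
  have -> : S1 ^+ 2 / a = n%:R ^+ 2 * ((C * (C * A ^ n.-1) ^ 2)%:R / A%:R).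
    rewrite eS1 aE -/C !(natrM, natrX); field; rewrite !lt0r_neq0 //.
  have reorder (x y z : R) : x * (y * (y * z)) = y ^+ 2 * (x * z) by ring.
  rewrite reorder.
  rewrite ler_wpM2l ?exprn_ge0 // ler_pdivlMr // -!natrM ler_nat.
  exact: q2.
rewrite Prob_GE -/C -natrX.
set p := #|[pred x | _ && [forall i, _]]| in sm.
apply: (@le_trans _ _ (p%:R / (C ^ n)%:R)).
  rewrite ler_wpM2r ?invr_ge0 // ler_nat; apply/subset_leq_card/fintype.subsetP => F.
  rewrite !inE => /andP[-> conn]; apply/forallP => v; apply: contraL conn.
  exact: isolated_disconnected.
rewrite ler_pdivrMr // -(ler_pM2r (exprn_gt0 2 S10)); apply: le_trans sm _.
rewrite [_ * (C ^ n)%:R]mulrC -mulrA ler_pM2l //.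
by rewrite mulrBl mul1r lerD2r [X in _ <= X]mulrC.
Qed.

Lemma bin_disjoint_ratio_ge m k : (0 < k)%N -> (k <= m)%N ->
  1 - k%:R ^+ 2 / m%:R <= ('C(m - k, k))%:R / ('C(m, k))%:R :> R.
Proof.
move=> k0 le_km; have m0 : 0 < m%:R :> R by rewrite ltr0n (leq_trans k0).
have C0 := natr_bin_gt0 R le_km.
rewrite ler_pdivlMr // -(ler_pM2l m0).
have := bin_disjoint_ge k0 le_km; rewrite -(ler_nat R) natrD !natrM => h.
have -> : m%:R * ((1 - k%:R ^+ 2 / m%:R) * ('C(m, k))%:R) =
  m%:R * ('C(m, k))%:R - k%:R * k%:R * ('C(m, k))%:R :> R.
  by field; rewrite lt0r_neq0.
lra.
Qed.

(** Invert 1+y <= exp(y) at y = x/(1-x), where 1+y = 1/(1-x). *)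
Lemma expR_le_1B (x : R) : x < 1 -> expR (- (x / (1 - x))) <= 1 - x.
Proof.
move=> x1; have x0 : 0 < 1 - x by lra.
rewrite expRN -[leRHS]invrK lef_pV2 ?posrE ?expR_gt0 ?invr_gt0 //.
apply: le_trans (expR_ge1Dx _).
suff -> : 1 + x / (1 - x) = (1 - x)^-1 by [].
by field; rewrite lt0r_neq0.
Qed.

(** With x = k^2/m, nx <= c ln n and a >= 1-x give n a^(n-1) >= n^((1-c)/2), while x -> 0 sends 1/a
    to 1. *)
Lemma Prob_connected_small (k m : nat -> nat) (c : R) (N : nat) :
  (forall n, (0 < k n)%N /\ (k n <= m n)%N) -> 0 <= c -> c < 1 ->
  (forall n, (N <= n)%N -> kkn_ratio R k m n <= c) ->
  forall e : R, 0 < e -> exists N', forall n, (N' <= n)%N ->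
  Prob_G R n (m n) (k n) (fun F => ig_connected F) <= e.
Proof.
move=> hk c0 c1 hc e e0.
(* Since x <= 4/ln n, the first three summands force x below 1/2, (1-c)/(1+c) and e/4; the last
   makes n^((1-c)/2) at least 2/e. *)
pose A : R := 8 + 4 * (1 + c) / (1 - c) + 16 / e + 4 / ((1 - c) * e).
have c1' : 0 < 1 - c by lra.
have [N1 hN1] := ln_natr_unbounded A.
exists (maxn N N1).+2 => n le_n.
have n1 : (1 < n)%N by apply: leq_trans le_n.
move: (ltnW (ltnW le_n)); rewrite geq_max => /andP[/hc {}hc /hN1 {}hN1].
have [kn0 knm] := hk n; have m0 : (0 < m n)%N := leq_trans kn0 knm.
have q1 : 0 <= 4 * (1 + c) / (1 - c) by rewrite divr_ge0 //; lra.
have q2 : 0 < 16 / e by rewrite divr_gt0.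
have q3 : 0 < 4 / ((1 - c) * e) by rewrite divr_gt0 // mulr_gt0.
have mR : 0 < (m n)%:R :> R by rewrite ltr0n.
have nR : 0 < n%:R :> R by rewrite ltr0n ltnW.
have nE : n%:R = expR (ln n%:R) :> R by rewrite lnK ?posrE.
set l := ln (n%:R : R) in hN1 nE.
have l8 : 8 <= l by apply: le_trans hN1; rewrite /A; lra.
have l0 : 0 < l by lra.
pose x : R := (k n)%:R ^+ 2 / (m n)%:R.
have x0 : 0 <= x by rewrite divr_ge0 ?exprn_ge0 // ltW.
have nx : n%:R * x <= c * l.
  move: hc; rewrite /kkn_ratio -/l ler_pdivrMr ?mulr_gt0 // => hc.
  rewrite /x mulrA ler_pdivrMr // mulrC; apply: le_trans hc _; lra.
(* Squares exp(l/2) >= 1 + l/2, with n = exp(l). *)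
have nl : l ^+ 2 / 4 <= n%:R.
  have h : 1 + l / 2 <= expR (l / 2) := expR_ge1Dx _.
  have -> : n%:R = expR (l / 2) ^+ 2 :> R.
    by rewrite nE -expRM_natl; congr expR; field.
  nra.
have xl : x <= 4 / l.
  rewrite ler_pdivlMr // -(ler_pM2r l0).
  have : l ^+ 2 / 4 * x <= n%:R * x by rewrite ler_wpM2r.
  have : c * l <= 1 * l by rewrite ler_wpM2r ?(ltW l0) // ltW.
  lra.
have xsmall (b : R) : 0 < b -> 4 / b <= l -> x <= b.
  move=> b0 hb; apply: le_trans xl _; rewrite ler_pdivrMr // mulrC.
  by rewrite -ler_pdivrMr.
have x2 : x <= 1 / 2 by apply: xsmall; lra.
have xc : x <= (1 - c) / (1 + c).
  apply: xsmall; first by rewrite divr_gt0 //; lra.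
  have -> : 4 / ((1 - c) / (1 + c)) = 4 * (1 + c) / (1 - c).
    by field; rewrite !lt0r_neq0 //; lra.
  by apply: le_trans hN1; rewrite /A; lra.
have xe : x <= e / 4.
  apply: xsmall; first by rewrite divr_gt0.
  have -> : 4 / (e / 4) = 16 / e by field; rewrite lt0r_neq0.
  by apply: le_trans hN1; rewrite /A; lra.
pose a : R := ('C(m n - k n, k n))%:R / ('C(m n, k n))%:R.
have ax : 1 - x <= a := bin_disjoint_ratio_ge kn0 knm.
have a0 : 0 < a by lra.
have Apos : (0 < 'C(m n - k n, k n))%N.
  by rewrite lt0n; apply: contraTneq a0 => A0; rewrite /a A0 mul0r ltxx.
have a1 : a <= 1.
  by rewrite ler_pdivrMr ?natr_bin_gt0 // mul1r ler_nat leq_bin2l // leq_subr.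
apply: le_trans (Prob_connected_second_moment n1 kn0 knm Apos (erefl a)) _.
(* For x <= 1/2, (1+2x)(1-x) >= 1, so 1/a <= 1+2x. *)
have ia : a^-1 - 1 <= e / 2.
  have : a^-1 <= 1 + 2 * x.
    rewrite -[leRHS]invrK lef_pV2 ?posrE ?invr_gt0 //; last by lra.
    apply: le_trans ax; rewrite invf_ple ?posrE; [|lra|lra].
    rewrite -[leLHS]mul1r ler_pdivrMr; last by lra.
    nra.
  lra.
have na : (n%:R * a ^+ n.-1)^-1 <= e / 2.
  have low : expR ((1 - c) / 2 * l) <= n%:R * a ^+ n.-1.
    have an : a ^+ n <= a ^+ n.-1.
      by rewrite ler_wiXn2l ?leq_pred // ltW.
    have x1 : 0 < 1 - x by lra.
    have xn : expR (- (x / (1 - x))) ^+ n <= a ^+ n.-1.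
      apply: le_trans an; rewrite lerXn2r ?nnegrE ?expR_ge0 ?(ltW a0) //.
      by apply: le_trans ax; apply: expR_le_1B; lra.
    apply: le_trans (ler_wpM2l (ltW nR) xn).
    rewrite -expRM_natl [X in _ <= X * _]nE -expRD ler_expR.
    (* The bound x <= (1-c)/(1+c) is equivalent to c <= (1-x)(1+c)/2, which absorbs the denominator
       1-x. *)
    suff : n%:R * (x / (1 - x)) <= (1 + c) / 2 * l by lra.
    rewrite mulrA ler_pdivrMr //; apply: le_trans nx _.
    have : x * (1 + c) <= 1 - c by rewrite -ler_pdivlMr //; lra.
    by move=> h; have := ler_wpM2r (ltW l0) h; lra.
  have pos : 0 < (1 - c) / 2 * l by rewrite !mulr_gt0 //; lra.
  rewrite invf_ple ?posrE ?divr_gt0 ?mulr_gt0 ?exprn_gt0 //.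
  apply: le_trans low; apply: le_trans (expR_ge1Dx _).
  have : 4 / ((1 - c) * e) <= l by apply: le_trans hN1; rewrite /A; lra.
  rewrite ler_pdivrMr ?mulr_gt0 // => h.
  rewrite invf_div ler_pdivrMr //.
  nra.
lra.
Qed.

End SecondMoment.

(** * Convergence of the two probabilities to 1 *)

Local Open Scope classical_set_scope.
Local Open Scope ring_scope.

Theorem theorem5 (R : realType) (k m : nat -> nat)
  (hk : forall n, (0 < k n)%N /\ (k n <= m n)%N)
  (hm : forall n, (n <= m n)%N) :
  ((1 < limn_einf (fun n => (kkn_ratio R k m n)%:E))%E ->
     (fun n => Prob_G R n (m n) (k n) (fun F => ig_connected F)) @ \oo --> (1 : R))
  /\
  ((limn_esup (fun n => (kkn_ratio R k m n)%:E) < 1)%E ->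
     (fun n => Prob_G R n (m n) (k n) (fun F => ~~ ig_connected F)) @ \oo --> (1 : R)).
Proof.
split.
  move=> /limn_einf_gt[c c1 [N hN]]; apply/cvgrPdist_le => e e0.
  have e4 : 0 < 4 / e by rewrite divr_gt0.
  (* With this [K], exp(K) >= 1+K >= 4/e, hence 4 exp(-K) <= e. *)
  have [|N' hN'] := Prob_disconnected_small hk hm c1 hN (K := 1 + 4 / e); first by lra.
  exists N' => // n /= /hN' small.
  rewrite Prob_GC ?(proj2 (hk n)) // opprB addrC subrK ger0_norm ?Prob_G_ge0 //.
  apply: le_trans small _; rewrite expRN ler_pdivrMr ?expR_gt0 // mulrC -ler_pdivrMr //.
  by apply: le_trans (expR_ge1Dx _); lra.
move=> /limn_esup_lt[c c1 [N hN]]; apply/cvgrPdist_le => e e0.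
have c0 : 0 <= c.
  (* The index [N.+1] is positive, so its logarithm and hence the ratio are nonnegative. *)
  apply: le_trans (hN N.+1 (leqnSn N)).
  by rewrite /kkn_ratio divr_ge0 ?mulr_ge0 ?exprn_ge0 // ln_ge0 // ler1n.
have [N' hN'] := Prob_connected_small hk c0 c1 hN e0.
exists N' => // n /= /hN' small.
rewrite Prob_GC ?(proj2 (hk n)) // opprB addrC subrK ger0_norm ?Prob_G_ge0 //.
apply: le_trans small; rewrite le_eqVlt; apply/orP; left; apply/eqP.
by congr Prob_G; apply: boolp.funext => F /=; rewrite negbK.
Qed.
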